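(* Let $\lambda_1,\lambda_2$ be integers with $\lambda_1\ge 5.8362\,\lambda_2>0$. Then $$C_{\lambda_1,\lambda_2}(-1,1):=\sum_{j=0}^{\lambda_2}(-1)^j\binom{\lambda_1}{j}\binom{\lambda_2}{j}\neq 0.$$ *)

(* Defs.v *)
From mathcomp Require Import all_boot all_order all_algebra.

Set Implicit Arguments.
Unset Strict Implicit.
Unset Printing Implicit Defensive.

Import GRing.Theory Num.Theory.

Local Open Scope ring_scope.

(* The integer $C_{\lambda_1,\lambda_2}(-1,1)$; the binomials are cast to int
   so that the alternating sum is not truncated. *)
Definition C_m1_1 (l1 l2 : nat) : int :=
  \sum_(0 <= j < l2.+1) (-1) ^+ j * 'C(l1, j)%:Z * 'C(l2, j)%:Z.

(* The exact rational 5.8362, written digit by digit: the literals 5.8362%Q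
   and 58362 would be expanded into unary numerals and overflow the stack. *)
Definition ratio_bound : rat :=
  5 + 8 / 10 + 3 / 10 ^+ 2 + 6 / 10 ^+ 3 + 2 / 10 ^+ 4.

(* Main.v *)
(** Up to the sign [(-1)^n], the sum is the coefficient of [X^n] in
    [p = (1 + X)^m (1 - X)^n] ([m] = lambda_1, [n] = lambda_2). From
    [(1 - X^2) p' = ((m - n) - (m + n) X) p] the coefficients satisfy
    [(k + 2) a_(k+2) = (m - n) a_(k+1) - (m + n - k) a_k], and as soon as
    [4 m n <= (m - n)^2] (that is, [m / n >= 3 + 2 sqrt 2 = 5.8284...])
    the inequality [(m - n) a_k <= 2 (k + 1) a_(k+1)] propagates up to [k = n - 1],
    so that [a_0, ..., a_n] are all positive. *)
Require Import Defs.
From mathcomp Require Import all_boot all_order all_algebra.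
From mathcomp Require Import ring lra zify.

Import Order.TTheory GRing.Theory Num.Theory.

Local Open Scope ring_scope.

(** The extra factor [q] restores the exponent lost by differentiation, which avoids [m.-1] and
    makes [m = 0] harmless. *)
Lemma mul_deriv_exp (R : comNzRingType) (q : {poly R}) (m : nat) :
  q * (q ^+ m)^`() = m%:R * q^`() * q ^+ m.
Proof.
case: m => [|m]; first by rewrite expr0 derivC mulr0 !mul0r.
rewrite deriv_exp -mulr_natl /= exprS; ring.
Qed.

Lemma coef_one_addZX_exp (R : comNzRingType) (c : R) (n i : nat) :
  ((1 + c *: 'X) ^+ n)`_i = c ^+ i * 'C(n, i)%:R.
Proof.
have -> : (1 + c *: 'X) ^+ n = \poly_(j < n.+1) (c ^+ j * 'C(n, j)%:R).
  rewrite poly_def exprDn; apply: eq_bigr => j _.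
  by rewrite expr1n mul1r exprZn mulr_natr -scalerMnl.
by rewrite coef_poly ltnS; case: leqP => // lt_ni; rewrite bin_small ?mulr0.
Qed.

Section KrawtchoukCoefficients.

Variables m n : nat.

Definition krawtchouk_gen : {poly int} := (1 + 'X) ^+ m * (1 - 'X) ^+ n.

(** Convolution gives the factor [(-1) ^+ (n - j) * 'C(n, n - j)]; binomial symmetry and the outer
    sign turn it into [(-1) ^+ j * 'C(n, j)]. *)
Lemma C_m1_1E : C_m1_1 m n = (-1) ^+ n * krawtchouk_gen`_n.
Proof.
rewrite /C_m1_1 coefM big_mkord big_distrr /=; apply: eq_bigr => j _.
have le_jn : (j <= n)%N by rewrite -ltnS.
rewrite -[X in 1 + X]scale1r -[- 'X]scaleN1r !coef_one_addZX_exp bin_sub //.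
rewrite expr1n mul1r !natz.
have -> : (-1) ^+ n = (-1) ^+ j * (-1) ^+ (n - j) :> int.
  by rewrite -exprD subnKC.
have := sqrr_sign int (n - j); move: ((-1) ^+ (n - j)) => e e2.
transitivity (e ^+ 2 * ((-1) ^+ j * 'C(m, j)%:Z * 'C(n, j)%:Z)); last by ring.
by rewrite e2 mul1r.
Qed.

(** This is the logarithmic derivative [m / (1 + X) - n / (1 - X)] with denominators cleared. *)
Lemma deriv_krawtchouk_gen :
  (1 - 'X^2) * krawtchouk_gen^`()
  = (m%:R - n%:R) * krawtchouk_gen - (m%:R + n%:R) * ('X * krawtchouk_gen).
Proof.
have hp := mul_deriv_exp _ (1 + 'X : {poly int}) m.
have hq := mul_deriv_exp _ (1 - 'X : {poly int}) n.
have d1 : 1^`() = 0 :> {poly int} by rewrite -polyC1 derivC.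
move: hp hq; rewrite derivB derivD derivX d1 add0r sub0r /krawtchouk_gen derivM.
move: ((1 - 'X) ^+ n) ((1 + 'X) ^+ m) => q p hp hq.
transitivity ((1 - 'X) * q * ((1 + 'X) * p^`())
              + (1 + 'X) * p * ((1 - 'X) * q^`())); first by ring.
by rewrite hp hq; ring.
Qed.

Lemma krawtchouk_rec (k : nat) :
  k.+2%:Z * krawtchouk_gen`_k.+2
  = (m%:Z - n%:Z) * krawtchouk_gen`_k.+1
    - (m%:Z + n%:Z - k%:Z) * krawtchouk_gen`_k.
Proof.
have := congr1 (fun p : {poly int} => p`_k.+1) deriv_krawtchouk_gen.
rewrite mulrBl mul1r !coefB -!natrD -!polyC_natr -polyCB.
rewrite coefXnM !coefCM coefXM !coef_deriv /=.
rewrite -![krawtchouk_gen`__ *+ _]mulr_natl natrD !natz.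
(* The coefficient of [X^(k+1)] in [X^2 p'] is [k a_k]; for [k = 0] it is the default [0], hence the
   case split. *)
by case: k => [|k]; move: krawtchouk_gen => p; rewrite ?subSS ?subn0;
  move=> /(canRL (subrK _)) ->; ring.
Qed.

Hypothesis le_n_m : (2 * n <= m)%N.
Hypothesis discr_ge0 : 4 * (m%:Z * n%:Z) <= (m%:Z - n%:Z) ^+ 2.

Lemma krawtchouk_coef_pos (k : nat) : (k < n)%N ->
  0 < krawtchouk_gen`_k /\
  (m%:Z - n%:Z) * krawtchouk_gen`_k <= 2 * k.+1%:Z * krawtchouk_gen`_k.+1.
Proof.
set a := fun k => krawtchouk_gen`_k.
have a0 : a 0%N = 1.
  rewrite /a /krawtchouk_gen -[X in 1 + X]scale1r -[- 'X]scaleN1r.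
  by rewrite coef0M !coef_one_addZX_exp !bin0 !expr0 !mulr1.
have a1 : a 1%N = m%:Z - n%:Z.
  rewrite /a /krawtchouk_gen -[X in 1 + X]scale1r -[- 'X]scaleN1r.
  rewrite coefM !big_ord_recl big_ord0 !coef_one_addZX_exp /= !bin0 !bin1.
  by rewrite !natz; ring.
elim: k => [|k IHk] lt_kn; rewrite -!/(a _); first by rewrite a0 a1; lia.
have [ak_gt0 le_ak] := IHk (ltnW lt_kn); rewrite -!/(a _) in ak_gt0 le_ak.
have rec := krawtchouk_rec k; rewrite -!/(a _) in rec.
move: (a k) (a k.+1) (a k.+2) ak_gt0 le_ak rec => x y z x_gt0 le_xy rec.
have D_gt0 : 0 < m%:Z - n%:Z by lia.
have y_gt0 : 0 < y.
  have : 0 < 2 * k.+1%:Z * y by apply: lt_le_trans le_xy; rewrite mulr_gt0.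
  by rewrite pmulr_rgt0.
split=> //.
(* [j (m + n + 1 - j)] is increasing for [j < n], and its value [(n - 1)(m + 2)]
   at [j = n - 1] is at most [m n]. *)
have le_mn : k.+1%:Z * (m%:Z + n%:Z - k%:Z) <= m%:Z * n%:Z by nia.
(* With [D = m - n] and [N = m + n - k], the recurrence reduces the goal to [2 N x <= D y]. After
   scaling by [D], the chain is [2 N D x <= 4 (k + 1) N y <= 4 m n y <= D^2 y]. *)
suff : (m%:Z - n%:Z) * (2 * (m%:Z + n%:Z - k%:Z) * x)
       <= (m%:Z - n%:Z) * ((m%:Z - n%:Z) * y).
  rewrite ler_pM2l //; nia.
have N_ge0 : 0 <= m%:Z + n%:Z - k%:Z by lia.
have := ler_wpM2l N_ge0 le_xy.
have := ler_wpM2r (ltW y_gt0) le_mn.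
have := ler_wpM2r (ltW y_gt0) discr_ge0.
nia.
Qed.

End KrawtchoukCoefficients.

Lemma discr_ge0_of_ratio (R : realFieldType) (x y : R) : 0 < y ->
  (5 + 8 / 10 + 3 / 10 ^+ 2 + 6 / 10 ^+ 3 + 2 / 10 ^+ 4) * y <= x ->
  2 * y <= x /\ 4 * (x * y) <= (x - y) ^+ 2.
Proof.
move=> y_gt0 ratio.
(* Any rational between [3 + 2 sqrt 2] and [5.8362] would do. *)
have {}ratio : 583 / 100 * y <= x by lra.
split; nra.
Qed.

Theorem theorem5 (l1 l2 : nat)
  (h_ratio : l1%:R >= ratio_bound * l2%:R)
  (h_pos : ratio_bound * l2%:R > 0) :
  C_m1_1 l1 l2 <> 0.
Proof.
have l2_gt0 : (0 < l2)%N.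
  by rewrite lt0n; apply: contraTneq h_pos => ->; rewrite mulr0 ltxx.
have [le_2n discr] : 2 * l2%:R <= l1%:R :> rat /\
    4 * (l1%:R * l2%:R) <= (l1%:R - l2%:R) ^+ 2 :> rat.
  by apply: discr_ge0_of_ratio; rewrite ?ltr0n.
have le_nm : (2 * l2 <= l1)%N by rewrite -(ler_nat rat) natrM.
have discrZ : 4 * (l1%:Z * l2%:Z) <= (l1%:Z - l2%:Z) ^+ 2.
  by rewrite -(ler_int rat) rmorphXn rmorphB !rmorphM.
case: l2 l2_gt0 le_nm discrZ {h_ratio h_pos le_2n discr} => // n _ le_nm discrZ.
(* Positivity is only given up to index [n]; the inequality at that last index carries it to [n.+1],
   the coefficient wanted. *)
have [an_gt0 le_an] := krawtchouk_coef_pos l1 n.+1 le_nm discrZ n (ltnSn n).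
apply/eqP; rewrite C_m1_1E mulf_eq0 signr_eq0 /= gt_eqF //.
have : 0 < 2 * n.+1%:Z * (krawtchouk_gen l1 n.+1)`_n.+1.
  by apply: lt_le_trans le_an; rewrite mulr_gt0 // subr_gt0 ltz_nat; lia.
by rewrite pmulr_rgt0.
Qed.
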